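(* For all integers $n\ge 1$ and $k\ge 0$ with $k<n-2$, $$NTI_{n,\mu}(q)|_{q^{\binom{n-1}{2}-k}}=NT_{n,\mu}(q)|_{q^{\binom{n-1}{2}-k}}=a(k),$$ where $a(k)$ is the number of integer partitions of $k$.
   Context: $\mathcal{C}_n$ is the set of $n$-cycles in the symmetric group $S_n$. An $n$-cycle is written $C=(c_0,c_1,\dots,c_{n-1})$ with $c_0=1$, viewed as a cyclic arrangement of $\{1,\dots,n\}$. We say $c_s$ is cyclically between $c_i$ and $c_j$ if $i<s<j$, or $j<i<s$, or $s<j<i$. For $a<b$ in $\{1,\dots,n\}$, the pair $\langle a,b\rangle$ is an occurrence of $\mu$ in $C$ if there is no $x$ with $a<x<b$ that is cyclically between $a$ and $b$ in $C$; it is nontrivial if $a+1<b$. $NT_\mu(C)$ denotes the number of nontrivial occurrences of $\mu$ in $C$. An $n$-cycle is incontractible if there is no $i$ with $1\le i\le n-1$ such that $i+1$ immediately follows $i$ in $C$; $\mathcal{IC}_n$ is the set of incontractible $n$-cycles. Define $NT_{n,\mu}(q)=\sum_{C\in\mathcal{C}_n} q^{NT_\mu(C)}$ and $NTI_{n,\mu}(q)=\sum_{C\in\mathcal{IC}_n} q^{NT_\mu(C)}$. $f(q)|_{q^j}$ means the coefficient of $q^j$ in $f(q)$. The number of partitions of $0$ is $1$. *)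

(* Defs.v *)
From mathcomp Require Import all_boot all_order all_algebra all_fingroup.

Set Implicit Arguments.
Unset Strict Implicit.
Unset Printing Implicit Defensive.

(* The ground set {1, ..., n} is represented by 'I_n, the
   letter i being the ordinal of value i - 1; all the notions below depend only
   on the relative order of the letters and on "i + 1 follows i". *)

Definition ncycles (n : nat) : {set 'S_n} :=
  [set C : 'S_n | porbits C == [set [set: 'I_n]]].

(* The entry c_i of C = (c_0, c_1, ..., c_(n-1)), where c_0 is the smallest
   letter and C maps each entry to the next one. The bound on i shows that the
   ground set is nonempty. *)
Definition cycle_entry (n : nat) (C : 'S_n) (i : 'I_n) : 'I_n :=
  (C ^+ i)%g (Ordinal (leq_ltn_trans (leq0n i) (ltn_ord i))).

Definition cyc_between (n : nat) (C : 'S_n) (x a b : 'I_n) : bool :=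
  [exists i : 'I_n, exists s : 'I_n, exists j : 'I_n,
    [&& cycle_entry C i == a, cycle_entry C s == x, cycle_entry C j == b
      & [|| i < s < j, j < i < s | s < j < i]]].

Definition mu_occ (n : nat) (C : 'S_n) (a b : 'I_n) : bool :=
  (a < b) && ~~ [exists x : 'I_n, (a < x < b) && cyc_between C x a b].

Definition NTmu (n : nat) (C : 'S_n) : nat :=
  #|[set ab : 'I_n * 'I_n | mu_occ C ab.1 ab.2 && (ab.1.+1 < ab.2)]|.

(* The last letter n imposes no condition: the value of C i is below n. *)
Definition incontractible (n : nat) (C : 'S_n) : bool :=
  ~~ [exists i : 'I_n, C i == i.+1 :> nat].

Definition incontractible_ncycles (n : nat) : {set 'S_n} :=
  [set C in ncycles n | incontractible C].

Definition NTpoly (n : nat) : {poly int} :=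
  (\sum_(C in ncycles n) 'X^(NTmu C))%R.

Definition NTIpoly (n : nat) : {poly int} :=
  (\sum_(C in incontractible_ncycles n) 'X^(NTmu C))%R.

Definition is_int_partition (k : nat) (s : seq nat) : bool :=
  [&& sorted geq s, all (fun m => 0 < m) s & sumn s == k].

(* A partition of k has at most k parts, each of them at most k, so that all of
   them are counted: see int_partition_bounded. *)
Definition num_int_partitions (k : nat) : nat :=
  #|[set p : {bseq k of 'I_k.+1} | is_int_partition k (map val p)]|.

Lemma int_partition_bounded (k : nat) (s : seq nat) :
  is_int_partition k s -> exists p : {bseq k of 'I_k.+1}, map val p = s.
Proof.
case/and3P=> _ pos_s /eqP sum_s.
have size_s : size s <= k.
  rewrite -sum_s; elim: s pos_s {sum_s} => //= m s IHs /andP[m_gt0 /IHs le_s].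
  by rewrite -add1n leq_add.
have lt_s m : m \in s -> m < k.+1.
  move=> s_m; rewrite ltnS -sum_s; elim: s s_m {pos_s sum_s size_s} => //= m' s IHs.
  rewrite inE => /predU1P[->|/IHs le_m]; first exact: leq_addr.
  exact: leq_trans le_m (leq_addl _ _).
have val_s : map val (map (@inord k) s) = s.
  rewrite -map_comp -[RHS]map_id; apply/eq_in_map => m /lt_s lt_m /=.
  exact: inordK.
have size_p : size (map (@inord k) s) <= k by rewrite size_map.
by exists (Bseq size_p).
Qed.

(* Main.v *)
(* An n-cycle has C(n-1, 2) - k nontrivial occurrences of mu exactly when k of its
   pairs a < b are separated by some intermediate letter. Reading the cycle from
   its largest letter m gives m :: w, and the separated pairs (a, m) are counted
   by d(w), the number of letters of w followed later by a larger one; the other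
   separated pairs are those of the cycle in which m is deleted. Inserting m + 1
   into m :: u ++ v between u and v gives the word w' = v ++ m :: u, with
   d(w') = |v| + d(u). Either d(u) = d(u ++ v), or u ++ v has an ascent starting
   at the last letter of u or later, and then m :: u ++ v already has
   at least |u| separated pairs. Hence, as long as k is below n - 2, the values of d for the successive deletions of the largest
   letter are weakly decreasing, and each admissible value is reached by exactly
   one insertion: the nonzero ones are the parts of a partition of k. A cycle in which i + 1
   follows i has at least n - 2 separated pairs, so it plays no role here. *)
Require Import Defs.
From mathcomp Require Import all_boot all_order all_algebra all_fingroup.
From mathcomp Require Import zify.

Set Implicit Arguments.
Unset Strict Implicit.
Unset Printing Implicit Defensive.

(** * Separated pairs in a word read cyclically *)

Definition cyc_ord (i k j : nat) : bool := [|| i < k < j, j < i < k | k < j < i].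

(* The word s is read cyclically. *)
Definition nonocc (s : seq nat) (a b : nat) : bool :=
  (a < b) && has (fun x => (a < x < b) &&
                           cyc_ord (index a s) (index x s) (index b s)) s.

Definition nnonocc (s : seq nat) : nat :=
  \sum_(a <- s) \sum_(b <- s) nonocc s a b.

(** The statistic d(w) of the opening comment. *)
Fixpoint novertaken (w : seq nat) : nat :=
  if w is a :: w' then has (ltn a) w' + novertaken w' else 0.

(** Exchanging the two blocks rotates all positions, and [cyc_ord] is invariant under rotation.
    Membership of [a] and [b] excludes the default index of an absent letter. *)
Lemma nonocc_catC (u v : seq nat) (a b : nat) :
  uniq (u ++ v) -> a \in u ++ v -> b \in u ++ v ->
  nonocc (v ++ u) a b = nonocc (u ++ v) a b.
Proof.
rewrite cat_uniq => /and3P[_ /hasPn/= dis _] a_s b_s; congr (_ && _).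
rewrite has_cat orbC -has_cat; apply: eq_in_has => x x_s; congr (_ && _).
have dis' z : z \in u -> z \in v = false.
  by move=> zu; apply/negP => /dis; rewrite zu.
have half z : z \in u ++ v ->
    (z \in u = true /\ z \in v = false /\ index z u < size u) \/
    (z \in u = false /\ z \in v = true /\ index z v < size v).
  rewrite mem_cat => /orP[zu|zv]; [left|right].
    by rewrite zu dis' // index_mem.
  by rewrite zv index_mem (negbTE (dis z zv)).
rewrite /cyc_ord !index_cat.
by case: (half a a_s) => -[-> [-> lta]]; case: (half b b_s) => -[-> [-> ltb]];
  case: (half x x_s) => -[-> [-> ltx]] /=; lia.
Qed.

Lemma nnonocc_catC (u v : seq nat) :
  uniq (u ++ v) -> nnonocc (v ++ u) = nnonocc (u ++ v).
Proof.
move=> uv_uniq; rewrite /nnonocc (perm_big (u ++ v)); last by rewrite /= perm_catC.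
apply: eq_big_seq => a a_s; rewrite (perm_big (u ++ v)); last by rewrite /= perm_catC.
by apply: eq_big_seq => b b_s; rewrite nonocc_catC.
Qed.

(** This is d in terms of positions, the form in which the separated pairs (a, m) appear once m
    stands at position 0. *)
Lemma sum_overtaken (w : seq nat) :
  uniq w ->
  \sum_(a <- w) has (fun x => (a < x) && (index a w < index x w)) w =
  novertaken w.
Proof.
elim: w => [|c w IHw] /=; first by rewrite big_nil.
case/andP=> c_w w_uniq; rewrite big_cons /= eqxx andbF /=.
congr (nat_of_bool _ + _).
  apply: eq_in_has => x x_w; have /negPf-> : c != x by apply: contraNneq c_w => ->.
  by rewrite andbT.
rewrite -IHw //; apply: eq_big_seq => a a_w.
have /negPf ca : c != a by apply: contraNneq c_w => ->.
rewrite ca ltn0 andbF /=; congr nat_of_bool; apply: eq_in_has => x x_w.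
by have /negPf-> : c != x by apply: contraNneq c_w => ->.
Qed.

(** With m at position 0, x lies between a and m exactly when x comes after a, so the pairs (a, m)
    contribute d(w). For the other pairs all positions shift by one, and m is too large to separate
    them. *)
Lemma nnonocc_cons_max (m : nat) (w : seq nat) :
  uniq w -> all (gtn m) w -> nnonocc (m :: w) = novertaken w + nnonocc w.
Proof.
move=> w_uniq /allP/= lt_m.
rewrite /nnonocc big_cons big1_seq ?add0n; last first.
  move=> b; rewrite /nonocc inE => /= /predU1P[->|/lt_m]; first by rewrite ltnn.
  by move=> lt_bm; rewrite ltnNge ltnW.
rewrite -(sum_overtaken w_uniq) -big_split; apply: eq_big_seq => a a_w.
rewrite big_cons; congr (_ + _).
  rewrite /nonocc lt_m //= /cyc_ord eqxx ltnn /=; congr nat_of_bool.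
  have /negPf-> : m != a by rewrite gtn_eqF // lt_m.
  rewrite andbF /=; apply: eq_in_has => x x_w; have /negPf-> : m != x by rewrite gtn_eqF // lt_m.
  by rewrite (lt_m x) // andbT; lia.
apply: eq_big_seq => b b_w; rewrite /nonocc /= [m < b]ltnNge (ltnW (lt_m _ b_w)) /=.
rewrite andbF /=; have /negPf-> : m != a by rewrite gtn_eqF // lt_m.
have /negPf-> : m != b by rewrite gtn_eqF // lt_m.
congr (nat_of_bool (_ && _)); apply: eq_in_has => x x_w.
by have /negPf-> : m != x by rewrite gtn_eqF // lt_m.
Qed.

(** * The statistic d under insertion of a largest letter *)

Lemma novertaken_cat_max (m : nat) (u v : seq nat) :
  all (gtn m) v -> all (gtn m) u ->
  novertaken (v ++ m :: u) = size v + novertaken u.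
Proof.
move=> + lt_u; elim: v => [_|a v IHv] /=.
  case: hasP => // -[x /(allP lt_u)/= lt_xm]; by rewrite ltnNge ltnW.
by case/andP=> lt_am /IHv->; rewrite has_cat /= lt_am orbT.
Qed.

(** In a descending tail no letter is overtaken, and a letter of [u] overtaken by a letter of [v] is
    already overtaken by [l]. *)
Lemma novertaken_cat_descent (u v : seq nat) (l : nat) :
  path gtn l v -> novertaken (rcons u l ++ v) = novertaken (rcons u l).
Proof.
move=> lv; have /allP/= lt_l : all (gtn l) v.
  by apply: order_path_min lv => x y z /= ? ?; lia.
elim: u => [|a u IHu] /=.
  elim: v l lv {lt_l} => [|b v IHv] l //= /andP[lt_bl bv].
  have /allP/= lt_b : all (gtn b) v.
    by apply: order_path_min bv => x y z /= ? ?; lia.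
  rewrite -(IHv b bv) /= ltnNge (ltnW lt_bl) /=.
  case: hasP => // -[x /lt_b lt_xb /= lt_lx]; lia.
rewrite IHu; congr (nat_of_bool _ + _); rewrite has_cat has_rcons.
case: (boolP (has (ltn a) u)) => _; rewrite ?orbT //= orbF.
case: (ltnP a l) => //= le_la; apply/hasP => -[x /lt_l lt_xl /=]; lia.
Qed.

(** The letter [y] overtakes [x] and every smaller letter of [u]; [x] accounts for the strict
    inequality. *)
Lemma novertaken_ascent (u v : seq nat) (x y : nat) :
  x < y -> count (gtn y) u < novertaken (u ++ x :: y :: v).
Proof.
move=> lt_xy; elim: u => [|a u IHu] /=; first by rewrite lt_xy.
rewrite has_cat /=; case: (ltnP a y) => _ /=; rewrite ?orbT; first by rewrite ltnS in IHu *.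
by apply: leq_trans IHu (leq_addl _ _).
Qed.

(* A letter a of u gives the separated pair (a, m) if a < y, and (x, a) if
   y < a; the last pair is (x, m). *)
Lemma nnonocc_ascent (m x y : nat) (u v : seq nat) :
  x < y -> uniq (u ++ x :: y :: v) -> all (gtn m) (u ++ x :: y :: v) ->
  size u < nnonocc (m :: u ++ x :: y :: v).
Proof.
move=> lt_xy w_uniq lt_m; rewrite nnonocc_cons_max //.
have := novertaken_ascent u v lt_xy.
suff: count (ltn y) u <= nnonocc (u ++ x :: y :: v).
  suff: count (gtn y) u + count (ltn y) u = size u by lia.
  have y_u : y \notin u.
    move: w_uniq; rewrite cat_uniq /= => /and3P[_ /norP[_ /norP[] //]].
  rewrite -[RHS](count_predC (gtn y)); congr (_ + _); apply: eq_in_count => a a_u /=.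
  have : a != y by apply: contraNneq y_u => <-.
  lia.
rewrite /nnonocc big_cat big_cons /=.
apply: leq_trans (leq_trans (leq_addr _ _) (leq_addl _ _)).
rewrite big_cat /=; apply: leq_trans (leq_addr _ _).
rewrite -sum1_count big_mkcond /=.
rewrite big_seq [in leqRHS]big_seq; apply: leq_sum => b b_u.
case: ltnP => //= lt_yb.
rewrite /nonocc (ltn_trans lt_xy) //=.
suff -> : has (fun z => (x < z < b) && cyc_ord (index x (u ++ x :: y :: v))
    (index z (u ++ x :: y :: v)) (index b (u ++ x :: y :: v)))
    (u ++ x :: y :: v) by [].
apply/hasP; exists y; first by rewrite mem_cat !inE eqxx !orbT.
move: w_uniq; rewrite cat_uniq /= !inE !negb_or.
case/and3P=> _ /and3P[/negPf x_u /negPf y_u _] /and3P[/andP[/negPf xy _] _ _].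
rewrite lt_xy lt_yb !index_cat x_u y_u b_u /= eqxx xy eqxx.
by have := b_u; rewrite -index_mem /cyc_ord addn0 addn1 ltnSn => ->; rewrite orbT.
Qed.

Lemma not_path_ascent (l : nat) (v : seq nat) :
  uniq (l :: v) -> ~~ path gtn l v ->
  exists v1 x y v2, [/\ x < y & l :: v = v1 ++ x :: y :: v2].
Proof.
elim: v l => [|b v IHv] l //= /and3P[lbv bv v_uniq].
have : l != b by move: lbv; rewrite inE => /norP[].
rewrite negb_and => lb /orP[le_lb|/IHv].
  by exists [::], l, b, v; split=> //; lia.
rewrite /= bv => /(_ v_uniq)[v1 [x [y [v2 [lt_xy ->]]]]].
by exists (l :: v1), x, y, v2.
Qed.

Lemma novertaken_prefix (m : nat) (u v : seq nat) :
  uniq (u ++ v) -> all (gtn m) (u ++ v) ->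
  novertaken (u ++ v) = novertaken u \/ size u <= nnonocc (m :: u ++ v).
Proof.
case/lastP: u => [|u l]; first by right.
move=> w_uniq lt_m; case: (boolP (path gtn l v)) => [/novertaken_cat_descent|nlv].
  by left.
right; have lv_uniq : uniq (l :: v).
  by move: w_uniq; rewrite cat_rcons cat_uniq => /and3P[].
have [v1 [x [y [v2 [lt_xy eq_lv]]]]] := not_path_ascent lv_uniq nlv.
move: w_uniq lt_m; rewrite cat_rcons eq_lv catA => w_uniq lt_m.
(* Of the prefix, possibly only [l] fails to precede the ascent; the strict bound makes up for
   it. *)
apply: leq_trans (nnonocc_ascent lt_xy w_uniq lt_m).
by rewrite size_rcons size_cat ltnS leq_addr.
Qed.

(** * The partition encoding a cycle *)

(* If w is the word of the cycle m.+1 :: w, then parent m w is the word, read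
   from m, of this cycle with m.+1 deleted. *)
Definition parent (m : nat) (w : seq nat) : seq nat :=
  drop (index m w).+1 w ++ take (index m w) w.

Lemma parent_cat (m : nat) (u v : seq nat) :
  m \notin v -> parent m (v ++ m :: u) = u ++ v.
Proof.
move=> /negPf m_v; rewrite /parent index_cat m_v /= eqxx addn0.
by rewrite take_size_cat // -cat_rcons drop_size_cat // size_rcons.
Qed.

(** Stopping at the first 0 loses nothing: d(w) = 0 forces w to be decreasing, hence determined by
    m. *)
Fixpoint code (m : nat) (w : seq nat) : seq nat :=
  if m is m'.+1 then
    if novertaken w == 0 then [::] else novertaken w :: code m' (parent m' w)
  else [::].

Lemma perm_iota_facts (m : nat) (w : seq nat) :
  perm_eq w (iota 0 m) -> [/\ uniq w, all (gtn m) w & size w = m].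
Proof.
move=> w_m; rewrite (perm_uniq w_m) iota_uniq (perm_all _ w_m) (perm_size w_m).
by rewrite size_iota; split=> //; apply/allP => x; rewrite mem_iota.
Qed.

Lemma perm_iotaS (m : nat) (s : seq nat) :
  perm_eq (m :: s) (iota 0 m.+1) = perm_eq s (iota 0 m).
Proof.
by rewrite -addn1 iotaD perm_sym perm_catC /= perm_cons perm_sym.
Qed.

Lemma word_split (m : nat) (w : seq nat) :
  perm_eq w (iota 0 m.+1) ->
  exists u v, w = v ++ m :: u /\ perm_eq (u ++ v) (iota 0 m).
Proof.
move=> w_m; have : m \in w by rewrite (perm_mem w_m) mem_iota leq0n add0n leqnn.
move=> m_w; case/splitPr: m_w w_m => v u w_m; exists u, v; split=> //.
by rewrite -perm_iotaS -cat_cons perm_catC.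
Qed.

Lemma child_facts (m : nat) (u v : seq nat) :
  perm_eq (u ++ v) (iota 0 m) ->
  [/\ perm_eq (v ++ m :: u) (iota 0 m.+1), parent m (v ++ m :: u) = u ++ v,
      novertaken (v ++ m :: u) = size v + novertaken u &
      nnonocc (m.+1 :: v ++ m :: u) =
      novertaken (v ++ m :: u) + nnonocc (m :: u ++ v)].
Proof.
move=> uv_m; have w_m : perm_eq (v ++ m :: u) (iota 0 m.+1).
  by rewrite perm_catC /= perm_iotaS.
have [w_uniq lt_w _] := perm_iota_facts w_m.
have [_ + _] := perm_iota_facts uv_m; rewrite all_cat => /andP[lt_u lt_v].
split=> //; first by apply: parent_cat; apply/negP => /(allP lt_v)/=; rewrite ltnn.
- by rewrite novertaken_cat_max.
by rewrite nnonocc_cons_max // -[m :: u ++ v]/((m :: u) ++ v) nnonocc_catC // uniq_catC.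
Qed.

Lemma novertaken_eq0 (w : seq nat) :
  uniq w -> novertaken w = 0 -> sorted gtn w.
Proof.
elim: w => //= a w IHw /andP[a_w w_uniq] /eqP.
rewrite addn_eq0 eqb0 => /andP[/hasPn/= le_a /eqP/(IHw w_uniq)].
case: w {IHw w_uniq} a_w le_a => //= b w + /(_ b (mem_head _ _)).
by rewrite inE => /norP[ab _] leba ->; rewrite andbT; lia.
Qed.

Lemma word_decreasing (m : nat) (w : seq nat) :
  perm_eq w (iota 0 m) -> novertaken w = 0 -> w = rev (iota 0 m).
Proof.
move=> w_m w_0; have [w_uniq _ _] := perm_iota_facts w_m.
apply: (@irr_sorted_eq _ gtn) => [y x z /= |x /=| | |x].
- lia.
- exact: ltnn.
- exact: novertaken_eq0.
- by rewrite rev_sorted iota_ltn_sorted.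
- by rewrite mem_rev (perm_mem w_m).
Qed.

Lemma rev_iota_facts (m : nat) :
  novertaken (rev (iota 0 m)) = 0 /\ nnonocc (m :: rev (iota 0 m)) = 0.
Proof.
elim: m => [|m [IH1 IH2]]; first by rewrite /nnonocc !big_cons !big_nil.
have -> : rev (iota 0 m.+1) = [::] ++ m :: rev (iota 0 m).
  by rewrite -addn1 iotaD rev_cat.
have [|_ _ def_d ->] := @child_facts m (rev (iota 0 m)) [::].
  by rewrite cats0 perm_rev.
by rewrite def_d cats0 IH1 IH2.
Qed.

(** The default 0 is the right value where the code has stopped, so consecutive values of d can be
    compared through the heads of codes. *)
Lemma head_code (m : nat) (w : seq nat) :
  perm_eq w (iota 0 m) -> head 0 (code m w) = novertaken w.
Proof.
case: m => [/perm_size/=/eqP|m _ /=]; first by rewrite size_eq0 => /eqP->.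
by case: eqP.
Qed.

(** In the other case of [novertaken_prefix] the parent has at least |u| separated pairs and the
    insertion adds at least |v|, in total m, against the bound. *)
Lemma novertaken_child (m : nat) (u v : seq nat) :
  perm_eq (u ++ v) (iota 0 m) ->
  (nnonocc (m.+1 :: v ++ m :: u)).+2 <= m.+1 ->
  novertaken (v ++ m :: u) = size v + novertaken (u ++ v).
Proof.
move=> uv_m; have [_ _ -> ->] := child_facts uv_m.
have [uv_uniq lt_uv size_uv] := perm_iota_facts uv_m.
have [->//|] := novertaken_prefix uv_uniq lt_uv.
by rewrite size_cat in size_uv => ? ?; have [_ _ H _] := child_facts uv_m; lia.
Qed.

Lemma code_partition (m : nat) (w : seq nat) :
  perm_eq w (iota 0 m) -> (nnonocc (m :: w)).+2 <= m ->
  is_int_partition (nnonocc (m :: w)) (code m w).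
Proof.
elim: m w => [|m IHm] w w_m small; first by [].
rewrite /is_int_partition /=; case: eqP => [w_0|/eqP w_0].
  by rewrite (word_decreasing w_m w_0) (rev_iota_facts _).2.
have [u [v [def_w uv_m]]] := word_split w_m; subst w.
have [_ par _ def_D] := child_facts uv_m.
have le_d := novertaken_child uv_m small.
rewrite par def_D /= eqn_add2l lt0n w_0 /=.
(* The part removed is at least 1, so the bound survives the passage from [m.+1] to [m]. *)
have /IHm: (nnonocc (m :: u ++ v)).+2 <= m by lia.
case/(_ uv_m)/and3P=> srt pos ->; rewrite pos !andbT.
have := head_code uv_m; case: (code m _) srt => //= p ps -> def_p.
by rewrite andbT def_p; lia.
Qed.

Lemma code_inj (m : nat) (w1 w2 : seq nat) :
  perm_eq w1 (iota 0 m) -> perm_eq w2 (iota 0 m) ->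
  (nnonocc (m :: w1)).+2 <= m -> (nnonocc (m :: w2)).+2 <= m ->
  code m w1 = code m w2 -> w1 = w2.
Proof.
elim: m w1 w2 => [|m IHm] w1 w2 w1_m w2_m small1 small2 //=.
case: eqP => [w1_0|/eqP w1_0]; case: eqP => [w2_0|/eqP w2_0] //.
  by rewrite (word_decreasing w1_m w1_0) (word_decreasing w2_m w2_0).
have [u1 [v1 [def_w uv1_m]]] := word_split w1_m; subst w1.
have [u2 [v2 [def_w uv2_m]]] := word_split w2_m; subst w2.
have [_ -> _ def_D1] := child_facts uv1_m.
have [_ -> _ def_D2] := child_facts uv2_m.
have d1 := novertaken_child uv1_m small1.
have d2 := novertaken_child uv2_m small2.
case=> eq_d /IHm eq_uv.
have {}eq_uv : u1 ++ v1 = u2 ++ v2 by apply: eq_uv => //; lia.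
(* The parents agree, so equal first parts force the same insertion place. *)
have eq_size : size v1 = size v2 by move: eq_d; rewrite d1 d2 eq_uv; lia.
have [_ _ s1] := perm_iota_facts uv1_m; have [_ _ s2] := perm_iota_facts uv2_m.
have /eqP := eq_uv; rewrite eqseq_cat; first by case/andP=> /eqP-> /eqP->.
by move: s1 s2; rewrite !size_cat eq_size => <- /addIn.
Qed.

Lemma code_surj (m : nat) (p : seq nat) :
  sorted geq p -> all (fun i => 0 < i) p -> (sumn p).+2 <= m ->
  exists w, [/\ perm_eq w (iota 0 m), nnonocc (m :: w) = sumn p & code m w = p].
Proof.
elim: m p => [|m IHm] [|j p] //=.
  exists (rev (iota 0 m.+1)); have [w_0 D_0] := rev_iota_facts m.+1.
  by rewrite perm_rev D_0 w_0.
move=> jp /andP[j_gt0 p_gt0] small.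
have [||w [w_m def_D def_p]] := IHm p _ p_gt0; first exact: path_sorted jp.
  lia.
have le_j : novertaken w <= j.
  rewrite -(head_code w_m) def_p; case: (p) jp => //= i p' /andP[] //.
have [w_uniq lt_w size_w] := perm_iota_facts w_m.
(* Here [t] is |u|, chosen so that |v| = j - d(w) and the new value of d is j. *)
pose t := m - (j - novertaken w).
have uv_m : perm_eq (take t w ++ drop t w) (iota 0 m) by rewrite cat_take_drop.
have [w'_m par def_d def_D'] := child_facts uv_m.
exists (drop t w ++ m :: take t w); rewrite cat_take_drop in par def_D'.
have eq_d : novertaken (drop t w ++ m :: take t w) = j.
  (* The second alternative would give t <= sumn p, whereas j + sumn p < m forces t > sumn p. *)
  have := @novertaken_prefix m (take t w) (drop t w).
  rewrite cat_take_drop size_takel ?size_w ?leq_subr // def_d size_drop size_w.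
  by case=> [||<-|] //; rewrite ?def_D /t; clear def_d; lia.
rewrite w'_m def_D' eq_d def_D; split=> //.
by rewrite par def_p; case: eqP => // j0; rewrite j0 in j_gt0.
Qed.

(** * Contractible cycles *)

(** Each letter b of [s] yields its own separated pair: (b, i+1), separated by i, if b < i, and (i,
    b), separated by i+1, if b > i+1. *)
Lemma nnonocc_contractible (i : nat) (s : seq nat) :
  uniq [:: i, i.+1 & s] -> size s <= nnonocc [:: i, i.+1 & s].
Proof.
move=> s_uniq; have mem_s b : b \in s -> (i == b) = false /\ (i.+1 == b) = false.
  move=> b_s; split; apply: contraTF s_uniq => /eqP def_b.
    by rewrite /= inE def_b b_s orbT.
  by rewrite /= def_b b_s /= andbF.
apply: (@leq_trans (\sum_(b <- s) (nonocc [:: i, i.+1 & s] i b +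
                                   nonocc [:: i, i.+1 & s] b i.+1))).
  rewrite -sum1_size [leqLHS]big_seq [leqRHS]big_seq; apply: leq_sum => b b_s.
  have eqS : (i == i.+1) = false by rewrite ltn_eqF.
  have [ib Sib] := mem_s b b_s; have [lt_bi|le_ib] := ltnP b i.
    apply: leq_trans (leq_addl _ _).
    have lt_bSi : b < i.+1 := leqW lt_bi.
    by rewrite /nonocc /= ib Sib eqS !eqxx lt_bi lt_bSi ltnSn.
  apply: leq_trans (leq_addr _ _); have lt_ib : i.+1 < b by lia.
  by rewrite /nonocc /= ib Sib eqS !eqxx (ltn_trans _ lt_ib) // lt_ib !ltnSn orbT.
rewrite /nnonocc big_split /= !big_cons; apply: leq_add.
  by rewrite addnA leq_addl.
by apply: leq_trans (leq_addl _ _); apply: leq_sum => b _; rewrite !big_cons; lia.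
Qed.

(** * Correspondence between n-cycles and words *)

(** The cycle is read from its largest letter, of value m, which is then omitted. *)
Definition word (m : nat) (C : 'S_m.+1) : seq nat :=
  map val (traject C (C ord_max) m).

Lemma ncycle_traject (m : nat) (C : 'S_m.+1) (x : 'I_m.+1) :
  C \in ncycles m.+1 ->
  [/\ uniq (traject C x m.+1), forall y, y \in traject C x m.+1 &
      fcycle C (traject C x m.+1)].
Proof.
rewrite inE => /eqP C_cyc; have Cx : porbit C x = setT.
  by apply/set1P; rewrite -C_cyc; apply: imset_f.
have card_Cx : #|porbit C x| = m.+1 by rewrite Cx cardsT card_ord.
split; first by have := uniq_traject_porbit C x; rewrite card_Cx.
  by move=> y; have := porbit_traject C x y; rewrite card_Cx Cx inE => <-.
have : iter m.+1 C x = x by have := iter_porbit C x; rewrite card_Cx.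
rewrite trajectS /= -iterS iterSr => Cmx.
by rewrite -[X in rcons _ X]Cmx -trajectSr fpath_traject.
Qed.

Lemma ncycle_traject_rot (m : nat) (C : 'S_m.+1) (x y : 'I_m.+1) :
  C \in ncycles m.+1 ->
  exists u v, traject C x m.+1 = u ++ v /\ traject C y m.+1 = v ++ u.
Proof.
move=> C_cyc; have [_ /(_ y) s_y s_C] := ncycle_traject x C_cyc.
have size_s := size_traject C x m.+1.
move: (traject C x m.+1) s_y s_C size_s => s s_y.
case/splitPr: s_y => u v; rewrite -(rot_cycle (size u)) rot_size_cat /=.
(* Rotated to start at [y], the closed path is a trajectory of [C]; its length k is found by
   comparing sizes. *)
case/fpathP=> k def_k size_uv; exists u, (y :: v); split=> //.
have def_km : k = m.+1.
  by move: size_uv; have := congr1 size def_k; rewrite size_rcons size_traject !size_cat /=; lia.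
by move: def_k; rewrite def_km trajectSr cat_cons => /rcons_inj[-> _].
Qed.

Lemma perm_word (m : nat) (C : 'S_m.+1) :
  C \in ncycles m.+1 -> perm_eq (word C) (iota 0 m).
Proof.
move=> /(ncycle_traject ord_max)[C_uniq C_all _].
rewrite -perm_iotaS -val_enum_ord.
apply: (perm_map val (s := traject C ord_max m.+1)).
by apply: uniq_perm; rewrite ?enum_uniq // => y; rewrite mem_enum C_all.
Qed.

(** This allows reading from c_0 as in the definitions, from the largest letter for the code, or
    from i when i+1 follows i. *)
Lemma nnonocc_traject (m : nat) (C : 'S_m.+1) (x y : 'I_m.+1) :
  C \in ncycles m.+1 ->
  nnonocc (map val (traject C x m.+1)) = nnonocc (map val (traject C y m.+1)).
Proof.
move=> C_cyc; have [C_uniq _ _] := ncycle_traject x C_cyc.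
have [u [v [def_x ->]]] := ncycle_traject_rot x y C_cyc; rewrite def_x in C_uniq *.
by rewrite !map_cat [RHS]nnonocc_catC // -map_cat (map_inj_uniq val_inj).
Qed.

Lemma ncycle_fcycle_inj (m : nat) (C1 C2 : 'S_m.+1) (s : seq 'I_m.+1) :
  (forall x, x \in s) -> fcycle C1 s -> fcycle C2 s -> C1 = C2.
Proof.
move=> s_all s_C1 s_C2; apply/permP => x.
by rewrite (eqP (next_cycle s_C1 (s_all x))) (eqP (next_cycle s_C2 (s_all x))).
Qed.

Lemma word_inj (m : nat) : {in ncycles m.+1 &, injective (@word m)}.
Proof.
move=> C1 C2 C1_cyc C2_cyc /(inj_map val_inj) eq_w.
have [_ s_all s_C1] := ncycle_traject ord_max C1_cyc.
have [_ _ s_C2] := ncycle_traject ord_max C2_cyc.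
by apply: ncycle_fcycle_inj s_all s_C1 _; rewrite /= eq_w.
Qed.

Lemma word_surj (m : nat) (w : seq nat) :
  perm_eq w (iota 0 m) -> exists2 C, C \in ncycles m.+1 & word C = w.
Proof.
rewrite -perm_iotaS => w_m; pose s : seq 'I_m.+1 := map inord (m :: w).
have val_s : map val s = m :: w.
  rewrite -map_comp -[RHS]map_id; apply/eq_in_map => i.
  by rewrite (perm_mem w_m) mem_iota => /andP[_ lt_i] /=; rewrite inordK.
have s_uniq : uniq s.
  by rewrite -(map_inj_uniq val_inj) val_s (perm_uniq w_m) iota_uniq.
have s_all x : x \in s.
  by rewrite -(mem_map val_inj) val_s (perm_mem w_m) mem_iota /= ltn_ord.
have next_inj : injective (next s) := can_inj (prev_next s_uniq).
(* The cycle sends each letter to its cyclic successor in [m :: w]. *)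
pose C : 'S_m.+1 := perm next_inj.
have size_s : size s = m.+1 by rewrite size_map (perm_size w_m) size_iota.
have : fcycle C s.
  by rewrite (eq_cycle (e' := frel (next s))) ?cycle_next // => x y /=; rewrite permE.
case: (s) val_s s_all size_s => [//|x t] [def_x def_w] t_all [size_t].
have {}def_x : x = ord_max by apply: val_inj.
subst x.
rewrite /= rcons_path => /andP[/fpathP[k def_t] _].
have {k} def_t : t = traject C (C ord_max) m.
  by move: size_t; rewrite def_t size_traject => ->.
exists C; last by rewrite /word -def_t.
have C_max : porbit C ord_max = setT.
  apply/setP => y; have := t_all y; rewrite in_setT def_t -trajectS.
  by case/trajectP=> i _ ->; rewrite -permX mem_porbit.
rewrite inE; apply/eqP/setP => A; rewrite in_set1; apply/imsetP/eqP => [[y _ ->]|->].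
  by rewrite -C_max; apply/eqP; rewrite eq_porbit_mem C_max inE.
by exists ord_max.
Qed.

(** * Nontrivial occurrences as the complement of separated pairs *)

(** A letter b = b' + 1 admits b' values of a, and b = 0 none. *)
Lemma sum_pairs (m : nat) :
  \sum_(a < m.+1) \sum_(b < m.+1) (a.+1 < b) = 'C(m, 2).
Proof.
have sum_lt (n c : nat) : \sum_(a < n) (a.+1 < c) = minn n c.-1.
  by elim: n => [|n IHn]; rewrite ?big_ord0 ?big_ord_recr /= ?IHn; lia.
rewrite exchange_big big_ord_recl /= big1 // add0n -bin2_sum big_mkord.
by apply: eq_bigr => b _; rewrite sum_lt /=; have := ltn_ord b; lia.
Qed.

(** The positions quantified in [cyc_between] are forced: they are the indices in the trajectory
    from c_0. *)
Lemma mu_occE (m : nat) (C : 'S_m.+1) (a b : 'I_m.+1) :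
  C \in ncycles m.+1 ->
  mu_occ C a b = (a < b) && ~~ nonocc (map val (traject C ord0 m.+1)) a b.
Proof.
move=> C_cyc; have [s_uniq s_all _] := ncycle_traject ord0 C_cyc.
rewrite /mu_occ /nonocc; case: ltnP => // lt_ab; rewrite !andTb; congr (~~ _).
have nth_s (i : 'I_m.+1) : cycle_entry C i = nth ord0 (traject C ord0 m.+1) i.
  rewrite /cycle_entry nth_traject // permX; congr iter; exact: val_inj.
have entry_index (i x : 'I_m.+1) :
    cycle_entry C i = x -> index x (traject C ord0 m.+1) = i.
  by rewrite nth_s => <-; rewrite index_uniq ?size_traject.
have lt_index x : index x (traject C ord0 m.+1) < m.+1.
  by have := s_all x; rewrite -index_mem size_traject.
have index_entry x : cycle_entry C (Ordinal (lt_index x)) = x.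
  by rewrite nth_s nth_index.
have cyc_betweenE x : cyc_between C x a b =
   cyc_ord (index a (traject C ord0 m.+1)) (index x (traject C ord0 m.+1))
           (index b (traject C ord0 m.+1)).
  apply/existsP/idP => [[i /existsP[k /existsP[j]]]|between].
    by case/and4P=> /eqP/entry_index-> /eqP/entry_index-> /eqP/entry_index->.
  exists (Ordinal (lt_index a)); apply/existsP; exists (Ordinal (lt_index x)).
  by apply/existsP; exists (Ordinal (lt_index b)); rewrite !index_entry !eqxx.
apply/existsP/hasP => [[x /andP[lt_x]]|[_ /mapP[x _ ->] /andP[lt_x]]].
  rewrite cyc_betweenE => between; exists (val x).
    by rewrite (mem_map val_inj) s_all.
  by rewrite lt_x !(index_map val_inj).
rewrite !(index_map val_inj) => between; exists x.
by rewrite lt_x cyc_betweenE.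
Qed.

(** A pair with a+1 < b is either an occurrence or separated; any other pair has no intermediate
    letter and counts on neither side. *)
Lemma NTmu_nnonocc (m : nat) (C : 'S_m.+1) :
  C \in ncycles m.+1 -> NTmu C + nnonocc (m :: word C) = 'C(m, 2).
Proof.
move=> C_cyc; have [s_uniq s_all _] := ncycle_traject ord0 C_cyc.
have -> : nnonocc (m :: word C) = nnonocc (map val (traject C ord0 m.+1)).
  by rewrite (nnonocc_traject _ ord_max).
rewrite -sum_pairs /NTmu -sum1dep_card big_mkcond.
rewrite -(pair_big predT predT (fun a b : 'I_m.+1 =>
  if mu_occ C a b && (a.+1 < b) then 1 else 0)).
have perm_s : perm_eq (traject C ord0 m.+1) (index_enum 'I_m.+1).
  by apply: uniq_perm; rewrite ?index_enum_uniq // => y; rewrite mem_index_enum s_all.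
rewrite /nnonocc big_map (perm_big _ perm_s) -big_split; apply: eq_bigr => a _.
rewrite big_map (perm_big _ perm_s) -big_split; apply: eq_bigr => b _.
rewrite mu_occE // /nonocc; case: (ltnP a.+1 b) => [lt_ab|le_ba].
  by rewrite (ltnW lt_ab) /= andbT; case: has.
rewrite andbF; case: (ltnP a b) => //= lt_ab; case: hasP => // -[x _]; lia.
Qed.

Lemma nnonocc_not_incontractible (m : nat) (C : 'S_m.+1) :
  C \in ncycles m.+1 -> ~~ incontractible C -> m <= (nnonocc (m :: word C)).+1.
Proof.
move=> C_cyc; rewrite negbK => /existsP[i /eqP Ci].
have -> : nnonocc (m :: word C) = nnonocc (map val (traject C i m.+1)).
  by rewrite (nnonocc_traject _ ord_max).
have [+ _ _] := ncycle_traject i C_cyc; rewrite -(map_inj_uniq val_inj).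
case: m => [|m] in C C_cyc i Ci * => //=; rewrite Ci => /nnonocc_contractible.
by rewrite size_map size_traject.
Qed.

(** * Counting cycles by partitions and reading off coefficients *)

(** Both sets are enumerated as lists of number sequences, cycles through [code]; the two lists are
    duplicate-free with the same elements. *)
Lemma num_ncycles_code (m k : nat) :
  k.+2 <= m ->
  #|[set C in ncycles m.+1 | nnonocc (m :: word C) == k]| = num_int_partitions k.
Proof.
move=> le_km; rewrite /num_int_partitions !cardE.
set A := [set C in _ | _]; set P := [set p | _].
rewrite -(size_map (fun C => code m (word C))).
rewrite -(size_map (fun p : {bseq k of 'I_k.+1} => map val p)).
apply/perm_size/uniq_perm.
- rewrite map_inj_in_uniq ?enum_uniq // => C1 C2; rewrite !mem_enum !inE.
  case/andP=> C1_cyc /eqP D1 /andP[C2_cyc /eqP D2].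
  move/code_inj=> eq_w; apply: word_inj; rewrite ?inE //.
  by apply: eq_w; rewrite ?D1 ?D2 // perm_word // inE.
- rewrite map_inj_uniq ?enum_uniq // => p1 p2 /(inj_map val_inj).
  exact: val_inj.
move=> p; apply/mapP/mapP => [[C]|[q]]; rewrite mem_enum inE.
  case/andP=> C_cyc /eqP D ->.
  have := code_partition (perm_word C_cyc); rewrite D => /(_ le_km) part.
  have [q def_q] := int_partition_bounded part.
  by exists q; rewrite // mem_enum inE def_q.
case/and3P=> srt pos /eqP sum_q ->; rewrite -sum_q in le_km.
have [w [/word_surj[C C_cyc <-] D code_w]] := code_surj srt pos le_km.
by exists C; rewrite ?code_w // mem_enum inE C_cyc D sum_q eqxx.
Qed.

Lemma coef_sum_Xn (n : nat) (A : {set 'S_n}) (j : nat) :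
  ((\sum_(C in A) 'X^(NTmu C) : {poly int})`_j)%R =
  Posz #|[set C in A | NTmu C == j]|.
Proof.
rewrite coef_sum (eq_bigr (fun C => ((NTmu C == j)%:R)%R)) => [|C _].
  by rewrite -GRing.natr_sum -sum1dep_card big_mkcondr natz.
by rewrite coefXn eq_sym.
Qed.

Theorem corollary17 (n k : nat) :
  1 <= n -> k < n - 2 ->
  ((NTIpoly n)`_('C(n - 1, 2) - k) = (NTpoly n)`_('C(n - 1, 2) - k))%R /\
  ((NTpoly n)`_('C(n - 1, 2) - k) = Posz (num_int_partitions k))%R.
Proof.
case: n => [//|m] _; rewrite (subSS 1 m) !subn1 /= => lt_k.
have le_km : k.+2 <= m by lia.
(* This keeps the subtraction in the exponent from being truncated. *)
have le_kC : k <= 'C(m, 2).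
  case: m le_km {lt_k} => [//|m] le_km; rewrite binS bin1; lia.
have NTmuE C : C \in ncycles m.+1 ->
    (NTmu C == 'C(m, 2) - k) = (nnonocc (m :: word C) == k).
  by move/NTmu_nnonocc; lia.
rewrite /NTIpoly /NTpoly !coef_sum_Xn -(num_ncycles_code le_km); split; congr Posz.
  apply: eq_card => C; rewrite !inE -andbA; apply: andb_id2l => C_cyc.
  have {}C_cyc : C \in ncycles m.+1 by rewrite inE.
  (* A contractible cycle has at least m - 1 > k separated pairs, so it misses this coefficient. *)
  rewrite NTmuE // andb_idl // => /eqP D; apply: contraLR le_km => ctr.
  have := nnonocc_not_incontractible C_cyc ctr; lia.
by apply: eq_card => C; rewrite !inE; apply: andb_id2l => C_cyc; rewrite NTmuE ?inE.
Qed.
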